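(* Let $n\ge 1$, let $\mathbf{x}=(x_0,\dots,x_n)\in\mathbb{Z}^{n+1}$ be a tuple of integers, not all zero, and let $\mathfrak{w}=(q_0,\dots,q_n)$ be a tuple of positive integers (weights) with $q_0<q_1<\cdots<q_n$. Then $$\operatorname{wgcd}_{\mathfrak{w}}(x_0,\dots,x_n)=\operatorname{wgcd}_{\mathfrak{w}}\bigl(\gcd(x_0,\dots,x_n),\ \gcd(x_1,\dots,x_n),\ \dots,\ \gcd(x_{n-1},x_n),\ x_n\bigr).$$
   Context: For a tuple of weights $\mathfrak{w}=(q_0,\dots,q_n)$ (positive integers) and a tuple of integers $\mathbf{x}=(x_0,\dots,x_n)$, not all zero, the weighted greatest common divisor $\operatorname{wgcd}_{\mathfrak{w}}(\mathbf{x})$ is the largest integer $d$ such that $d^{q_i}\mid x_i$ for all $i=0,\dots,n$ (such an integer exists). The ordinary $\gcd$ of a tuple of integers, not all zero, is the largest integer dividing all entries, with the convention that the gcd of a tuple of zeros is $0$. *)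

(* Defs.v *)
From mathcomp Require Import all_boot all_order all_algebra.
From mathcomp Require Import boolp classical_sets.

Set Implicit Arguments.
Unset Strict Implicit.
Unset Printing Implicit Defensive.

Import Order.TTheory GRing.Theory Num.Theory.
Local Open Scope ring_scope.

Definition is_wgcd (m : nat) (q : 'I_m -> nat) (x : 'I_m -> int) (d : int)
    : Prop :=
  (forall i, (d ^+ q i %| x i)%Z) /\
  (forall e : int, (forall i, (e ^+ q i %| x i)%Z) -> e <= d).

(* The default value 0 is only reached when no largest integer exists; see
   [wgcdP] for positive weights and a tuple that is not all zero. *)
Definition wgcd (m : nat) (q : 'I_m -> nat) (x : 'I_m -> int) : int :=
  xget 0 (is_wgcd q x).

(* [gcdz] is nonnegative and [gcdz 0 0 = 0], so the gcd of a zero tail is 0;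
   see [tail_gcdP] when the tail is not all zero. *)
Definition tail_gcd (m : nat) (x : 'I_m -> int) (i : 'I_m) : int :=
  \big[gcdz/0]_(j < m | (i <= j)%N) x j.

(* (gcd(x_0,...,x_n), gcd(x_1,...,x_n), ..., gcd(x_{n-1},x_n), x_n): the last
   entry is x_n itself, with its sign, rather than gcd(x_n) = |x_n|. *)
Definition tail_gcds (n : nat) (x : 'I_n.+1 -> int) (i : 'I_n.+1) : int :=
  if i == ord_max then x ord_max else tail_gcd x i.

Lemma le_int_of_dvdz (d z : int) : z != 0 -> (d %| z)%Z -> d <= `|z|%N%:Z.
Proof.
move=> z0 dz; apply: le_trans (lez_abs d) _; rewrite lez_nat.
by apply: dvdn_leq; rewrite // absz_gt0.
Qed.

Lemma wgcdP (m : nat) (q : 'I_m -> nat) (x : 'I_m -> int) :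
  (forall i, (0 < q i)%N) -> (exists i, x i != 0) -> is_wgcd q x (wgcd q x).
Proof.
move=> q0 [k xk0]; apply: (@xgetPex _ 0 (is_wgcd q x)).
pose P (d : nat) := [forall i, ((d%:Z) ^+ q i %| x i)%Z].
have P1 : exists d, P d.
  by exists 1%N; apply/forallP => i; rewrite expr1n dvd1z.
have bnd (e : int) : (forall i, (e ^+ q i %| x i)%Z) -> e <= `|x k|%N%:Z.
  move=> ex; apply: le_int_of_dvdz xk0 _.
  by apply: dvdz_trans (ex k); apply: dvdz_exp.
have Pbnd d : P d -> (d <= `|x k|)%N.
  by move=> /forallP Pd; rewrite -lez_nat; apply: bnd.
case: (ex_maxnP P1 Pbnd) => d /forallP Pd dmax.
exists d%:Z; split=> // -[e|e] ex; last by [].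
by rewrite lez_nat; apply: dmax; apply/forallP.
Qed.

Lemma is_wgcd_uniq (m : nat) (q : 'I_m -> nat) (x : 'I_m -> int) (d e : int) :
  is_wgcd q x d -> is_wgcd q x e -> d = e.
Proof.
by move=> [dx dmax] [ex emax]; apply/eqP; rewrite eq_le emax // dmax.
Qed.

Lemma tail_gcdP (m : nat) (x : 'I_m -> int) (i : 'I_m) :
  (exists2 k : 'I_m, (i <= k)%N & x k != 0) ->
  (forall j : 'I_m, (i <= j)%N -> (tail_gcd x i %| x j)%Z) /\
  (forall e : int, (forall j : 'I_m, (i <= j)%N -> (e %| x j)%Z) ->
     e <= tail_gcd x i).
Proof.
move=> [k ik xk0].
have gdvd (j : 'I_m) : (i <= j)%N -> (tail_gcd x i %| x j)%Z.
  rewrite /tail_gcd => ij.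
  have: j \in index_enum 'I_m by rewrite mem_index_enum.
  elim: (index_enum _) => // a s IH; rewrite big_cons inE => /orP[/eqP<-|js].
    by rewrite ij dvdz_gcdl.
  by case: ifP => _; [apply: dvdz_trans (dvdz_gcdr _ _) _|]; apply: IH.
split=> // e ex.
have g0 : 0 <= tail_gcd x i.
  by rewrite /tail_gcd; elim/big_rec: _.
have gn0 : tail_gcd x i != 0.
  by apply: contraNneq xk0 => g; have := gdvd k ik; rewrite g dvd0z.
rewrite -(gez0_abs g0); apply: le_int_of_dvdz gn0 _.
rewrite /tail_gcd; elim/big_rec: _ => [|j y ij ey]; first exact: dvdz0.
by rewrite dvdz_gcd ex.
Qed.

(* Main.v *)
Require Import Defs.
From mathcomp Require Import all_boot all_order all_algebra.
From mathcomp Require Import classical_sets.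

Local Open Scope ring_scope.

(** A weighted gcd is determined by the set of integers [e] whose weighted
    powers [e ^+ q i] divide the tuple entrywise, so it is enough to see that
    the tuple and its tuple of tail gcds admit the same such [e]
    ([weighted_dvdz_tail_gcds]).  The [i]-th tail gcd divides [x i], which
    gives one inclusion.  Conversely, for [i <= j] the weights satisfy
    [q i <= q j], hence [e ^+ q i] divides [e ^+ q j], which divides [x j]:
    so [e ^+ q i] divides every entry of the [i]-th tail, that is, its gcd. *)

Lemma dvdz_tail_gcd (m : nat) (x : 'I_m -> int) (i : 'I_m) (d : int) :
  (d %| tail_gcd x i)%Z <-> (forall j : 'I_m, (i <= j)%N -> (d %| x j)%Z).
Proof.
rewrite /tail_gcd.
rewrite (big_morph (fun y => (d %| y)%Z) (dvdz_gcd d) (dvdz0 d)) big_andE.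
by split=> [/forall_inP | dx]; last apply/forall_inP.
Qed.

(** The last entry of [tail_gcds x] differs from the last tail gcd at most by
    its sign, so divisibility sees all the entries in the same way. *)
Lemma dvdz_tail_gcds (n : nat) (x : 'I_n.+1 -> int) (i : 'I_n.+1) (d : int) :
  (d %| tail_gcds x i)%Z <->
  (forall j : 'I_n.+1, (i <= j)%N -> (d %| x j)%Z).
Proof.
rewrite /tail_gcds; case: eqVneq => [-> | _]; last exact: dvdz_tail_gcd.
split=> [dx j maxj | ]; last by apply.
by have /val_inj -> : val j = val (@ord_max n)
  by apply/eqP; rewrite eqn_leq maxj -ltnS ltn_ord.
Qed.

Lemma weighted_dvdz_tail_gcds (n : nat) (x : 'I_n.+1 -> int)
    (q : 'I_n.+1 -> nat) (e : int) :
  (forall i j : 'I_n.+1, (i <= j)%N -> (q i <= q j)%N) ->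
  (forall i, (e ^+ q i %| x i)%Z) <->
  (forall i, (e ^+ q i %| tail_gcds x i)%Z).
Proof.
move=> q_mono; split=> [ex i | ex i].
  apply/dvdz_tail_gcds => j ij.
  by apply: dvdz_trans (ex j); apply: dvdz_exp2l; apply: q_mono.
by have /dvdz_tail_gcds := ex i; apply.
Qed.

Lemma eq_is_wgcd (m : nat) (q : 'I_m -> nat) (x y : 'I_m -> int) (d : int) :
  (forall e : int, (forall i, (e ^+ q i %| x i)%Z) <->
                   (forall i, (e ^+ q i %| y i)%Z)) ->
  is_wgcd q x d -> is_wgcd q y d.
Proof.
by move=> xy [dx dmax]; split=> [|e /xy]; [apply/xy | apply: dmax].
Qed.

Theorem theorem4 (n : nat) (hn : (1 <= n)%N)
    (x : 'I_n.+1 -> int) (hx : exists i : 'I_n.+1, x i != 0)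
    (q : 'I_n.+1 -> nat) (hq0 : forall i : 'I_n.+1, (0 < q i)%N)
    (hq : forall i j : 'I_n.+1, (i < j)%N -> (q i < q j)%N) :
  wgcd q x = wgcd q (tail_gcds x).
Proof.
have q_mono (i j : 'I_n.+1) : (i <= j)%N -> (q i <= q j)%N.
  by rewrite leq_eqVlt => /orP[/eqP/val_inj-> // | /hq/ltnW].
have tail_wgcd : is_wgcd q (tail_gcds x) (wgcd q x).
  apply: eq_is_wgcd (wgcdP hq0 hx) => e.
  exact: weighted_dvdz_tail_gcds q_mono.
apply: (is_wgcd_uniq tail_wgcd).
exact: (xgetPex 0 (ex_intro (is_wgcd q (tail_gcds x)) _ tail_wgcd)).
Qed.
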